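(* Let $X$ be a nonempty set, $\Theta$ be a nonempty open interval of $\mathbb{R}$, and $\psi\in\Psi[T_1](X,\Theta)$. If $\psi\in\Psi[T_n](X,\Theta)$ for some $n\in\mathbb{N}\setminus\{1\}$, then, for each $x,y\in X$ with $\vartheta_1(x)<\vartheta_1(y)$, the function $$(\vartheta_1(x),\vartheta_1(y))\ni t\mapsto\frac{\psi(x,t)}{\psi(x,t)-\psi(y,t)}$$ is strictly $\frac1n$-increasing.
   Context: $\mathbb{N}$ is the set of positive integers. For a nonempty open interval $I$ of $\mathbb{R}$ and $\varepsilon>0$, a function $f:I\to\mathbb{R}$ is strictly $\varepsilon$-increasing if $f(u)<f(v)+\varepsilon$ for all $u,v\in I$ with $u<v$. Point of sign change: for $f:\Theta\to\mathbb{R}$, an element $\vartheta\in\Theta$ is a point of sign change (of decreasing type) for $f$ if $f(t)>0$ for all $t\in\Theta$ with $t<\vartheta$ and $f(t)<0$ for all $t\in\Theta$ with $t>\vartheta$. $\Psi(X,\Theta)$ is the class of functions $\psi:X\times\Theta\to\mathbb{R}$ such that for each $x\in X$ there exist $t_+,t_-\in\Theta$ with $t_+<t_-$ and $\psi(x,t_+)>0>\psi(x,t_-)$. $\psi\in\Psi[T_n](X,\Theta)$ means that $\psi\in\Psi(X,\Theta)$ and for every $(x_1,\ldots,x_n)\in X^n$ the function $\Theta\ni t\mapsto\sum_{i=1}^n\psi(x_i,t)$ has a (necessarily unique) point of sign change, denoted $\vartheta_n(x_1,\ldots,x_n)$. *)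

(* Defs.v *)
From HB Require Import structures.
From mathcomp Require Import all_boot all_order all_algebra.
From mathcomp Require Import all_classical all_reals topology normedtype.
Set Implicit Arguments.
Unset Strict Implicit.
Unset Printing Implicit Defensive.
Import Order.TTheory GRing.Theory Num.Theory.
Import numFieldNormedType.Exports.
Local Open Scope classical_set_scope.
Local Open Scope ring_scope.

(* Functions with domain Theta (a subset of R) are represented by total
   functions on R; all the notions below only look at their values on Theta. *)

Definition open_interval (R : realType) (I : set R) : Prop :=
  [/\ I !=set0, open I & is_interval I].

Definition strictly_eps_increasing (R : realType) (eps : R) (I : set R)
    (f : R -> R) : Prop :=
  forall u v : R, I u -> I v -> u < v -> f u < f v + eps.

Definition sign_change_point (R : realType) (Theta : set R) (f : R -> R)
    (s : R) : Prop :=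
  [/\ Theta s,
      forall t, Theta t -> t < s -> 0 < f t &
      forall t, Theta t -> s < t -> f t < 0].

Definition Psi (R : realType) (X : Type) (Theta : set R) :
    set (X -> R -> R) :=
  [set psi | forall x, exists tp tm : R,
     [/\ Theta tp, Theta tm, tp < tm, 0 < psi x tp & psi x tm < 0]].
Arguments Psi {R} X Theta.

Definition psi_sum (R : realType) (X : Type) (psi : X -> R -> R) (n : nat)
    (xs : n.-tuple X) (t : R) : R :=
  \sum_(i < n) psi (tnth xs i) t.

Definition PsiT (R : realType) (n : nat) (X : Type) (Theta : set R) :
    set (X -> R -> R) :=
  [set psi | Psi X Theta psi /\
     forall xs : n.-tuple X, exists s, sign_change_point Theta (psi_sum psi xs) s].
Arguments PsiT {R} n X Theta.

(* The point of sign change when there is one (it is unique if Theta is an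
   open interval); the default value 0 is irrelevant otherwise. *)
Definition vartheta (R : realType) (X : Type) (Theta : set R)
    (psi : X -> R -> R) (n : nat) (xs : n.-tuple X) : R :=
  xget 0 [set s | sign_change_point Theta (psi_sum psi xs) s].

Definition vartheta1 (R : realType) (X : Type) (Theta : set R)
    (psi : X -> R -> R) (x : X) : R :=
  vartheta Theta psi [tuple x].

(* Main.v *)
Require Import Defs.
From HB Require Import structures.
From mathcomp Require Import all_boot all_order all_algebra.
From mathcomp Require Import all_classical all_reals topology normedtype.
From mathcomp Require Import ring.
Set Implicit Arguments.
Unset Strict Implicit.
Unset Printing Implicit Defensive.
Import Order.TTheory GRing.Theory Num.Theory.
Import numFieldNormedType.Exports.
Local Open Scope classical_set_scope.
Local Open Scope ring_scope.

(** Write f t for the quotient of the statement. Between the two points of sign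
change one has psi x t < 0 < psi y t, so f takes values in [0, 1], and the
sample consisting of m copies of y and n - m copies of x satisfies
  m * psi y t + (n - m) * psi x t = (psi y t - psi x t) * (m - n * f t).
So the sign of this sum at t tells on which side of m the number n * f t lies
([mixture_factor]). A function with a point of sign change, once nonpositive,
is negative at all later points ([sign_change_point_lt0]); hence m <= n * f u
implies m < n * f v for u < v. Taking for m the integer part of n * f u gives
n * f u < m + 1 < n * f v + 1, which is the claim. *)

(** A nonpositive value at u forces u to lie at or beyond s. *)
Lemma sign_change_point_lt0 (R : realType) (Theta : set R) (f : R -> R)
    (s u v : R) :
  sign_change_point Theta f s -> Theta u -> Theta v -> u < v ->
  f u <= 0 -> f v < 0.
Proof.
move=> [_ fpos fneg] Tu Tv uv fu; apply: fneg => //.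
apply: le_lt_trans uv; rewrite leNgt; apply/negP => us.
by have := fpos _ Tu us; rewrite ltNge fu.
Qed.

Lemma vartheta1P (R : realType) (X : Type) (Theta : set R) (psi : X -> R -> R)
    (x : X) :
  PsiT 1 X Theta psi ->
  sign_change_point Theta (psi x) (vartheta1 Theta psi x).
Proof.
move=> [_ /(_ [tuple x])] scp.
have -> : psi x = psi_sum psi [tuple x].
  by apply/funext => t; rewrite /psi_sum big_ord1 (tnth_nth x).
exact: xgetPex.
Qed.

Lemma psi_sum_two_valued (R : realType) (X : Type) (psi : X -> R -> R)
    (n m : nat) (x y : X) (t : R) : (m <= n)%N ->
  psi_sum psi [tuple (if (i < m)%N then y else x) | i < n] t =
  m%:R * psi y t + (n%:R - m%:R) * psi x t.
Proof.
move=> mn; rewrite /psi_sum.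
under eq_bigr => i _ do rewrite tnth_mktuple.
rewrite -(big_mkord xpredT (fun i => psi (if (i < m)%N then y else x) t)).
rewrite (big_cat_nat _ mn) //=; congr (_ + _).
- rewrite (eq_big_nat _ _ (F2 := fun=> psi y t)); last first.
    by move=> i /andP[_ ->].
  by rewrite sumr_const_nat subn0 mulr_natl.
- rewrite (eq_big_nat _ _ (F2 := fun=> psi x t)); last first.
    by move=> i /andP[mi _]; rewrite ltnNge mi.
  by rewrite sumr_const_nat -natrB // mulr_natl.
Qed.

(** Here a and b stand for psi x t and psi y t, and a / (a - b) is the weight w
at which w * b + (1 - w) * a vanishes. *)
Lemma mixture_factor (F : fieldType) (a b m n : F) : a - b != 0 ->
  m * b + (n - m) * a = (b - a) * (m - n * (a / (a - b))).
Proof. by move=> ab; field. Qed.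

Theorem proposition2p15 (R : realType) (X : Type) (hX : inhabited X)
    (Theta : set R) (hTheta : open_interval Theta)
    (psi : X -> R -> R) (hpsi1 : PsiT 1 X Theta psi)
    (n : nat) (hn : (1 < n)%N) (hpsin : PsiT n X Theta psi)
    (x y : X) (hxy : vartheta1 Theta psi x < vartheta1 Theta psi y) :
  strictly_eps_increasing (n%:R^-1)
    [set t | vartheta1 Theta psi x < t < vartheta1 Theta psi y]
    (fun t => psi x t / (psi x t - psi y t)).
Proof.
move=> u v Iu Iv uv.
have [Tx _ xneg] := vartheta1P x hpsi1.
have [Ty ypos _] := vartheta1P y hpsi1.
have ITheta t : vartheta1 Theta psi x < t < vartheta1 Theta psi y -> Theta t.
  move=> /andP[xt ty]; have [_ _ itvT] := hTheta.
  by apply: (itvT _ _ Tx Ty); rewrite !ltW.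
have psi_sign t : vartheta1 Theta psi x < t < vartheta1 Theta psi y ->
    psi x t < 0 < psi y t.
  by move=> It; have /andP[xt ty] := It; rewrite xneg ?ypos //; exact: ITheta.
pose f t := psi x t / (psi x t - psi y t).
have n_gt0 : 0 < n%:R :> R by rewrite ltr0n ltnW.
have f_itv : 0 <= f u <= 1.
  have /andP[xu yu] := psi_sign _ Iu.
  have d_lt0 : psi x u - psi y u < 0.
    by rewrite subr_lt0 (lt_trans xu).
  rewrite /f ler_ndivlMr // ler_ndivrMr // mul0r mul1r.
  by apply/andP; split; [exact: ltW | rewrite gerDl oppr_le0 ltW].
have nf_ge0 : 0 <= n%:R * f u by case/andP: f_itv => f_ge0 _; rewrite mulr_ge0.
pose m := Num.truncn (n%:R * f u).
have /andP[m_le lt_m1] : m%:R <= n%:R * f u < m.+1%:R by exact: truncn_itv.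
have mn : (m <= n)%N.
  rewrite -(ler_nat R); apply: le_trans m_le _.
  by case/andP: f_itv => _ f_le1; rewrite ler_piMr.
have [_ /(_ [tuple (if (i < m)%N then y else x) | i < n])[s scp]] := hpsin.
have sumE t : vartheta1 Theta psi x < t < vartheta1 Theta psi y ->
    0 < psi y t - psi x t /\
    psi_sum psi [tuple (if (i < m)%N then y else x) | i < n] t =
    (psi y t - psi x t) * (m%:R - n%:R * f t).
  move=> /psi_sign/andP[xt yt]; split.
    by rewrite subr_gt0 (lt_trans xt).
  rewrite psi_sum_two_valued // mixture_factor // lt_eqF // subr_lt0.
  exact: lt_trans yt.
have [du Eu] := sumE _ Iu; have [dv Ev] := sumE _ Iv.
have := sign_change_point_lt0 scp (ITheta _ Iu) (ITheta _ Iv) uv.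
rewrite Eu Ev pmulr_rle0 // pmulr_rlt0 // subr_le0 subr_lt0 => /(_ m_le) m_lt.
rewrite -[ltLHS]/(f u) -[X in _ < X + _]/(f v).
rewrite -(ltr_pM2l n_gt0) mulrDr divff ?gt_eqF //.
by apply: lt_trans lt_m1 _; rewrite -natr1 ltrD2r.
Qed.
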